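(* Let $p$ be a complex polynomial of degree $d\ge 1$ with $d$ simple roots $\lambda_1,\dots,\lambda_d\in\mathbb C$. Assume that all roots $\lambda_k$ of $p$ have rational real and imaginary parts. If $\varphi$ is holomorphic at the roots (i.e. in a neighbourhood of $\{\lambda_1,\dots,\lambda_d\}$) and all the values $\varphi^{(\nu)}(\lambda_k)$, $\nu\ge 0$, $k=1,\dots,d$, also have rational real and imaginary parts, then for every $k=1,\dots,d$ the power series expansion $f_k(w)=\sum_{j\ge 0}\alpha_{k,j}w^j$ of the $k$-th component of the multicentric representation of $\varphi$ has coefficients $\alpha_{k,j}$ with rational real and imaginary parts only.
   Context: For $k=1,\dots,d$ let $\delta_k$ be the Lagrange basis polynomial of degree $d-1$ with $\delta_k(\lambda_k)=1$ and $\delta_k(\lambda_j)=0$ for $j\neq k$. For $\varphi$ holomorphic in a neighbourhood of $\{\lambda_1,\dots,\lambda_d\}$ (the neighbourhood need not be connected), the multicentric representation of $\varphi$ is $$\varphi(z)=\sum_{k=1}^d \delta_k(z)\, f_k(p(z)),$$ valid for all $z$ with $|p(z)|$ sufficiently small, where $f_1,\dots,f_d$ are the (uniquely determined) functions holomorphic in a neighbourhood of $0$ for which this holds; write $f_k(w)=\sum_{j\ge 0}\alpha_{k,j}w^j$.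
   Formalization: The leading coefficient of p is additionally assumed to have rational real and imaginary parts (e.g. p monic); without this the claim fails, for instance for p(z) = πz and φ(z) = z, where f_1(w) = w/π. *)

(* Defs.v *)
From HB Require Import structures.
From mathcomp Require Import all_boot all_order all_algebra.
From mathcomp Require Import all_classical all_reals all_analysis.
From mathcomp Require Import complex.

Set Implicit Arguments.
Unset Strict Implicit.
Unset Printing Implicit Defensive.

Import Order.TTheory GRing.Theory Num.Theory numFieldNormedType.Exports.

Local Open Scope ring_scope.
Local Open Scope classical_set_scope.

(* [R[i]] packaged as a [numClosedFieldType]: the topology and the normed
   module structure of a numeric field are keyed on the carrier of such a
   structure, and are not inferred on the bare type [R[i]]. *)
Definition Cplx (R : realType) : numClosedFieldType := complex R.

Definition gaussian_rational (R : realType) (z : Cplx R) : Prop :=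
  rational (complex.Re z) /\ rational (complex.Im z).

(* Scalars range over [Cplx R], so [derivable f z 1] is differentiability in
   the complex sense. *)
Definition holomorphic_near (R : realType) (A : set (Cplx R))
    (f : Cplx R -> Cplx R) : Prop :=
  exists U : set (Cplx R),
    [/\ open U, A `<=` U & forall z, U z -> derivable f z 1].

Definition lagrange_basis (F : fieldType) (d : nat) (lam : 'I_d -> F)
    (k : 'I_d) : {poly F} :=
  \prod_(j < d | j != k) ((lam k - lam j)^-1 *: ('X - (lam j)%:P)).

Lemma lagrange_basisE (F : fieldType) (d : nat) (lam : 'I_d -> F)
    (k j : 'I_d) :
  injective lam -> (lagrange_basis lam k).[lam j] = (j == k)%:R.
Proof.
move=> lam_inj; rewrite /lagrange_basis horner_prod.
have [->|jk] := eqVneq j k; last first.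
  by rewrite (bigD1 j) //= hornerZ hornerXsubC subrr mulr0 mul0r.
rewrite big1 // => i ik; rewrite hornerZ hornerXsubC mulVf //.
by rewrite subr_eq0 (inj_eq lam_inj) eq_sym.
Qed.

Lemma size_lagrange_basis (F : fieldType) (d : nat) (lam : 'I_d -> F)
    (k : 'I_d) :
  injective lam -> size (lagrange_basis lam k) = d.
Proof.
move=> lam_inj; rewrite /lagrange_basis.
have sz i : i != k ->
    size ((lam k - lam i)^-1 *: ('X - (lam i)%:P)) = 2%N.
  move=> ik; rewrite size_scale ?size_XsubC //.
  by rewrite invr_eq0 subr_eq0 (inj_eq lam_inj) eq_sym.
rewrite size_prod => [|i ik]; last by rewrite -size_poly_gt0 sz.
rewrite (eq_bigr (fun=> 2%N)) // sum_nat_const cardC1 card_ord muln2 -addnn.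
by case: d lam k lam_inj {sz} => [? []|n _ _ _] //; rewrite -addSn addnK.
Qed.

(* [phi] is a total function whose values away from the roots are arbitrary;
   a small enough sublevel set of [|p|] lies in any given neighbourhood of the
   roots of [p]. The order on [Cplx R] makes [0 < r] say that [r] is a positive
   real. *)
Definition multicentric_representation (R : realType) (d : nat)
    (p : {poly Cplx R}) (lam : 'I_d -> Cplx R) (phi : Cplx R -> Cplx R)
    (f : 'I_d -> Cplx R -> Cplx R) : Prop :=
  (forall k, holomorphic_near [set 0] (f k)) /\
  exists2 r : Cplx R, 0 < r &
    forall z, `|p.[z]| < r ->
      phi z = \sum_(k < d) (lagrange_basis lam k).[z] * f k p.[z].

Definition power_series_expansion (R : realType) (f : Cplx R -> Cplx R)
    (alpha : nat -> Cplx R) : Prop :=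
  \forall w \near (0 : Cplx R),
    series (fun j => alpha j * w ^+ j) @ \oo --> f w.

(* Main.v *)
From HB Require Import structures.
Require Import Defs.
From mathcomp Require Import all_boot all_order all_algebra.
From mathcomp Require Import all_classical all_reals all_analysis.
From mathcomp Require Import complex ring.
Import Order.TTheory GRing.Theory Num.Theory numFieldNormedType.Exports.
Local Open Scope ring_scope.
Local Open Scope classical_set_scope.

Set Implicit Arguments.
Unset Strict Implicit.
Unset Printing Implicit Defensive.

(** Why the theorem holds. Fix an order [j] and truncate every [f_k] to the
    polynomial [A_k] of its terms of degree at most [j]. The polynomial
    [P = \sum_k delta_k * (A_k \Po p)] differs from [phi] by a multiple of
    [p ^+ j.+1] near each root of [p], so [phi] and [P] have the same derivatives
    up to order [j] there ([multicentric_jet]). Isolating the terms of degree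
    [j] gives
    [P = Q + p ^+ j * S], where [Q] involves only coefficients of index less than
    [j] and [S = \sum_k alpha_(k,j) delta_k] takes the value [alpha_(m,j)] at
    [lambda_m]. With [p = ('X - lambda_m) q], the [j]-th derivative at
    [lambda_m] reads
    [phi^(j)(lambda_m) = Q^(j)(lambda_m) + j! q(lambda_m)^j alpha_(m,j)].
    Since [q(lambda_m) != 0], this expresses [alpha_(m,j)] by field operations
    in terms of [phi^(j)(lambda_m)], the coefficients of [p], the roots, and
    coefficients [alpha_(k,i)] with [i < j]. The Gaussian rationals form a field,
    so strong induction on [j] concludes.

    The analytic content is that the iterated derivatives of
    [z |-> f_k (p z)] are those predicted by formal differentiation. It reduces to
    one fact, [power_series_expansion_derive1]: the sum of a complex power
    series is differentiable near [0], and its derivative is the sum of the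
    derived series. Everything else is the Leibniz and chain rules, carried
    through the predicate [jet]. *)

(** * Termwise differentiation of power series *)

Section PowerSeries.
Variable K : numFieldType.
Implicit Types (z h w r rho M D : K) (alpha : nat -> K) (F : K -> K).

(** The second-order remainder [E_n] of [z ^+ n] obeys
    [E_(n+1) = (z + h) E_n + n h^2 z^(n-1)], whence the quadratic bound by
    induction. The factor [r ^+ 2] on the left stands for [r ^+ (n - 2)] on the
    right, which would be a truncated exponent. *)
Lemma expr_increment_bound z h r n : 0 <= r -> `|z| <= r -> `|z + h| <= r ->
  `|(z + h) ^+ n - z ^+ n - n%:R * h * z ^+ n.-1| * r ^+ 2
    <= n%:R ^+ 2 * r ^+ n * `|h| ^+ 2.
Proof.
move=> r0 zr zhr; elim: n => [|n IH].
  by rewrite !expr0 subrr !mul0r subrr normr0 mul0r expr0n !mul0r.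
have -> : (z + h) ^+ n.+1 - z ^+ n.+1 - n.+1%:R * h * z ^+ n.+1.-1 =
    (z + h) * ((z + h) ^+ n - z ^+ n - n%:R * h * z ^+ n.-1)
    + n%:R * h ^+ 2 * z ^+ n.-1.
  case: n {IH} => [|n] /=; first by rewrite expr1 !expr0; ring.
  by rewrite !exprS -!natr1; ring.
have zn : n%:R * (`|z| ^+ n.-1 * r ^+ 2) <= n%:R * r ^+ n.+1.
  case: n {IH} => [|n]; first by rewrite !mul0r.
  rewrite ler_wpM2l // -[n.+2]addn2 exprD.
  by rewrite ler_wpM2r ?exprn_ge0 // lerXn2r ?nnegrE.
have h2 : 0 <= `|h| ^+ 2 by rewrite exprn_ge0.
apply: (@le_trans _ _ (r * (n%:R ^+ 2 * r ^+ n * `|h| ^+ 2)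
                       + n%:R * r ^+ n.+1 * `|h| ^+ 2)).
  apply: (@le_trans _ _ (`|z + h| *
      (`|(z + h) ^+ n - z ^+ n - n%:R * h * z ^+ n.-1| * r ^+ 2)
      + n%:R * (`|z| ^+ n.-1 * r ^+ 2) * `|h| ^+ 2)).
    rewrite (le_trans (ler_wpM2r _ (ler_normD _ _))) ?exprn_ge0 //.
    rewrite !normrM !normrX normr_nat le_eqVlt; apply/orP; left; apply/eqP.
    ring.
  apply: lerD; last by rewrite ler_wpM2r.
  by rewrite ler_pM // mulr_ge0 ?exprn_ge0.
have -> : r * (n%:R ^+ 2 * r ^+ n * `|h| ^+ 2) + n%:R * r ^+ n.+1 * `|h| ^+ 2
    = (n%:R ^+ 2 + n%:R) * r ^+ n.+1 * `|h| ^+ 2 by rewrite [r ^+ n.+1]exprS; ring.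
rewrite ler_wpM2r // ler_wpM2r ?exprn_ge0 //.
rewrite -!natrX -natrD ler_nat -[n.+1]addn1 sqrnD muln1 -addnA leq_add2l.
by rewrite mul2n -addnn addnA leq_addl.
Qed.

Lemma pseries_coef_bounded alpha w : cvgn (series (fun j => alpha j * w ^+ j)) ->
  exists2 M, 0 <= M & forall n, `|alpha n| * `|w| ^+ n <= M.
Proof.
move=> /cvg_seq_bounded [M [Mreal bM]].
have bM1 n : `|series (fun j => alpha j * w ^+ j) n| <= M + 1.
  by apply: bM => //; rewrite ltrDl.
have M0 : 0 <= M + 1 := le_trans (normr_ge0 _) (bM1 0%N).
exists (M + 1 + (M + 1)) => [|n]; first exact: addr_ge0.
rewrite -normrX -normrM.
have -> : alpha n * w ^+ n = series (fun j => alpha j * w ^+ j) n.+1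
    - series (fun j => alpha j * w ^+ j) n.
  by rewrite /series /= big_nat_recr //= addrAC subrr add0r.
by rewrite (le_trans (ler_normB _ _)) // lerD.
Qed.

(** The ratio [1 / 8] absorbs any factor up to [4 ^ i], such as [i ^ 2], and
    still leaves a geometric series of ratio [1 / 2]. *)
Lemma natr_eighth_exp_le m i : (m <= 4 ^ i)%N ->
  m%:R * 8^-1 ^+ i <= 2^-1 ^+ i :> K.
Proof.
move=> mi; rewrite -[in leLHS](_ : 4^-1 * 2^-1 = 8^-1 :> K); last by field.
rewrite exprMn mulrA -[leRHS]mul1r ler_wpM2r ?exprn_ge0 ?invr_ge0 //.
by rewrite exprVn ler_pdivrMr ?exprn_gt0 // mul1r -!natrX ler_nat.
Qed.

(** On the disc of radius [rho / 8] the remainders of all partial sums are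
    quadratic in [h] with the same constant, so that the bound passes to the
    limit. *)
Lemma pseries_increment_bound alpha rho M z h n : 0 < rho ->
  (forall n, `|alpha n| * rho ^+ n <= M) ->
  `|z| <= rho / 8 -> `|z + h| <= rho / 8 ->
  `|\sum_(i < n) alpha i * ((z + h) ^+ i - z ^+ i - i%:R * h * z ^+ i.-1)|
    * (rho / 8) ^+ 2 <= 2 * M * `|h| ^+ 2.
Proof.
move=> rho0 bM zr zhr; set r := rho / 8 in zr zhr *.
have r0 : 0 <= r by rewrite divr_ge0 // ltW.
have M0 : 0 <= M.
  by apply: le_trans (bM 0%N); rewrite mulr_ge0 // exprn_ge0 // ltW.
have term i : `|alpha i * ((z + h) ^+ i - z ^+ i - i%:R * h * z ^+ i.-1)|
    * r ^+ 2 <= M * `|h| ^+ 2 * 2^-1 ^+ i.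
  rewrite normrM -[leLHS]mulrA.
  apply: (le_trans (ler_wpM2l _ (expr_increment_bound i r0 zr zhr))) => //.
  have -> : `|alpha i| * (i%:R ^+ 2 * r ^+ i * `|h| ^+ 2) =
      (`|alpha i| * rho ^+ i) * `|h| ^+ 2 * (i%:R ^+ 2 * 8^-1 ^+ i).
    by rewrite /r exprMn; ring.
  have rho0' := ltW rho0.
  apply: ler_pM.
  - by do !(apply: mulr_ge0 || apply: exprn_ge0).
  - by do !(apply: mulr_ge0 || apply: exprn_ge0); rewrite ?invr_ge0.
  - by rewrite ler_wpM2r ?exprn_ge0.
  rewrite -natrX natr_eighth_exp_le // (_ : 4 = 2 ^ 2)%N // -expnM mulnC expnM.
  by rewrite leq_exp2r // ltnW // ltn_expl.
have geo m : \sum_(i < m) 2^-1 ^+ i <= 2 :> K.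
  have -> : \sum_(i < m) 2^-1 ^+ i = 2 - 2 * 2^-1 ^+ m :> K.
    elim: m => [|m IH]; first by rewrite big_ord0 expr0 mulr1 subrr.
    by rewrite big_ord_recr /= IH exprS mulrA divff // mul1r mulr2n mulrDl; ring.
  by rewrite gerBl mulr_ge0 // exprn_ge0 // invr_ge0.
apply: (@le_trans _ _ (M * `|h| ^+ 2 * \sum_(i < n) 2^-1 ^+ i)).
  rewrite (le_trans (ler_wpM2r _ (ler_norm_sum _ _ _))) ?exprn_ge0 //.
  by rewrite mulr_suml mulr_sumr ler_sum.
have -> : 2 * M * `|h| ^+ 2 = M * `|h| ^+ 2 * 2 by ring.
by rewrite ler_wpM2l // mulr_ge0 // exprn_ge0.
Qed.

Lemma is_derive_quadratic F z D C r : 0 < r -> 0 <= C ->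
  (forall h, h != 0 -> `|h| < r ->
     `|F (z + h) - F z - h * D| <= C * `|h| ^+ 2) ->
  is_derive z (1 : K) F D.
Proof.
move=> r0 C0 quad.
suff lim : h^-1 *: (F (h *: (1 : K) + z) - F z) @[h --> 0^'] --> D.
  split; first by apply/cvg_ex; exists D.
  exact: cvg_lim lim.
apply/cvgrPdist_lt => e e0.
near=> h.
have hn0 : h != 0 by near: h; exact: nbhs_dnbhs_neq.
have hr : `|h| < r by near: h; apply: dnbhs0_lt.
have he : `|h| < e / (C + 1).
  by near: h; apply: dnbhs0_lt; rewrite divr_gt0 // ltr_wpDl.
have -> : D - h^-1 *: (F (h *: (1 : K) + z) - F z)
   = - (h^-1 * (F (z + h) - F z - h * D)).
  rewrite (_ : h *: (1 : K) + z = z + h); last first.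
    by rewrite addrC; congr (_ + _); exact: mulr1.
  rewrite mulrBr mulKf // opprB; congr (_ - _).
rewrite normrN normrM normfV ltr_pdivrMl ?normr_gt0 //.
apply: le_lt_trans (quad h hn0 hr) _.
rewrite expr2 mulrA mulrC ltr_pM2l ?normr_gt0 //.
apply: (@le_lt_trans _ _ ((C + 1) * `|h|)).
  by rewrite ler_wpM2r // lerDl.
by rewrite mulrC -ltr_pdivlMr // ltr_wpDl.
Unshelve. all: by end_near. Qed.

(** Letting the number of terms tend to infinity in [pseries_increment_bound]
    makes [F (z + h) - F z - h * D] quadratic in [h]. A numeric field need not be
    complete, which is why the sum [D] of the derived series is given. *)
Lemma is_derive_pseries alpha F rho M D z : 0 < rho ->
  (forall n, `|alpha n| * rho ^+ n <= M) ->
  (forall w, `|w| <= rho / 8 ->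
    series (fun j => alpha j * w ^+ j) @ \oo --> F w) ->
  `|z| < rho / 8 ->
  series (fun j => j.+1%:R * alpha j.+1 * z ^+ j) @ \oo --> D ->
  is_derive z (1 : K) F D.
Proof.
move=> rho0 bM serF zr serD; set r := rho / 8 in serF zr.
have r0 : 0 < r by rewrite divr_gt0.
have M0 : 0 <= M.
  by apply: le_trans (bM 0%N); rewrite mulr_ge0 // exprn_ge0 // ltW.
apply: (@is_derive_quadratic F z D (2 * M / r ^+ 2 + 1) (r - `|z|)).
- by rewrite subr_gt0.
- by rewrite addr_ge0 // divr_ge0 ?exprn_ge0 ?mulr_ge0 // ltW.
move=> h hn0 hr.
have zhr : `|z + h| <= r.
  by rewrite (le_trans (ler_normD _ _)) // addrC -lerBrDr ltW.
pose S n := \sum_(i < n) alpha i * ((z + h) ^+ i - z ^+ i - i%:R * h * z ^+ i.-1).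
have SE n : S n.+1 = series (fun j => alpha j * (z + h) ^+ j) n.+1
    - series (fun j => alpha j * z ^+ j) n.+1
    - h * series (fun j => j.+1%:R * alpha j.+1 * z ^+ j) n.
  rewrite /S /series /= !big_mkord mulr_sumr.
  rewrite [in RHS]big_ord_recl [in X in _ - X - _]big_ord_recl.
  rewrite big_ord_recl /= !expr0 subrr !mul0r subrr mulr0 add0r.
  rewrite opprD addrACA subrr add0r -!sumrB; apply: eq_bigr => i _.
  by rewrite /bump /= add1n; ring.
have limS : S n.+1 @[n --> \oo] --> F (z + h) - F z - h * D.
  have -> : (fun n => S n.+1) = (fun n => series (fun j => alpha j * (z + h) ^+ j) n.+1
    - series (fun j => alpha j * z ^+ j) n.+1
    - h * series (fun j => j.+1%:R * alpha j.+1 * z ^+ j) n) by apply/funext.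
  apply: cvgB; first apply: cvgB.
  - by have := serF _ zhr; rewrite -cvg_shiftS.
  - by have := serF _ (ltW zr); rewrite -cvg_shiftS.
  - by apply: cvgM; [exact: cvg_cst|exact: serD].
(* The limit of [S] is within [`|h| ^+ 2] of some partial sum: this costs 1 in
   the constant and avoids passing to the limit in an inequality. *)
have h2 : 0 < `|h| ^+ 2 by rewrite exprn_gt0 // normr_gt0.
have /cvgrPdist_lt /(_ _ h2) [n _ near_lim] := limS.
have Sn : `|S n.+1| <= 2 * M / r ^+ 2 * `|h| ^+ 2.
  rewrite mulrAC ler_pdivlMr ?exprn_gt0 //.
  exact: (pseries_increment_bound n.+1 rho0 bM (ltW zr) zhr).
rewrite -[X in `|X|](subrK (S n.+1)) mulrDl mul1r addrC.
by rewrite (le_trans (ler_normD _ _)) // lerD // ltW // near_lim /=.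
Qed.

End PowerSeries.

(** * Complex power series *)

Section ComplexSeries.
Variable R : realType.
Local Open Scope complex_scope.

Lemma Cplx_ge0E (x : Cplx R) : 0 <= x -> x = (complex.Re x)%:C.
Proof. by move=> x0; rewrite RRe_real // ger0_real. Qed.

Lemma real_complex_cvg (u : nat -> R) (l : R) : u @ \oo --> l ->
  (fun n => (u n)%:C : Cplx R) @ \oo --> (l%:C : Cplx R).
Proof.
move=> /cvgrPdist_lt ul; apply/cvgrPdist_lt => e e0.
have eE := Cplx_ge0E (ltW e0).
have Re0 : 0 < complex.Re e by rewrite eE ltcR in e0.
apply: (@filterS _ (nbhs \oo) _ _ _ _ (ul _ Re0)) => n /=.
by rewrite -rmorphB /= normc_def /= expr0n addr0 sqrtr_sqr eE ltcR.
Qed.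

(** Domination by a geometric series is enough: the real and imaginary parts
    are then absolutely convergent real series, and completeness of [R] sums
    them separately. *)
Lemma Cplx_series_cvg (a : nat -> Cplx R) (M : Cplx R) :
  (forall n, `|a n| <= M * 2^-1 ^+ n) -> cvgn (series a).
Proof.
move=> aM.
have M0 : 0 <= M by have := le_trans (normr_ge0 _) (aM 0%N); rewrite expr0 mulr1.
have half : (2^-1 : Cplx R) = (2^-1 : R)%:C by rewrite fmorphV rmorph_nat.
have part (f : nat -> R) : (forall n, `|f n|%:C <= `|a n|) -> cvgn (series f).
  move=> fa; apply: normed_cvg.
  apply: (@series_le_cvg _ _ (geometric (complex.Re M) 2^-1)) => [n|n /=|n /=|].
  - exact: normr_ge0.
  - apply: mulr_ge0; first by rewrite -ler0c -Cplx_ge0E.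
    by rewrite exprn_ge0 // invr_ge0.
  - have := le_trans (fa n) (aM n).
    by rewrite (Cplx_ge0E M0) half -rmorphXn -rmorphM lecR.
  - by apply: is_cvg_geometric_series; rewrite ger0_norm ?invr_ge0 // invf_lt1 // ltr1n.
have cRe : cvgn (series (fun n => complex.Re (a n))).
  by apply: part => n; exact: normc_ge_Re.
have cIm : cvgn (series (fun n => complex.Im (a n))).
  apply: part => n.
  rewrite -normrN -ReiNIm (le_trans (normc_ge_Re _)) // normrM.
  by rewrite [`|'i%C|]normc_def /= expr0n expr1n add0r sqrtr1 mulr1.
have -> : series a = (fun n => (series (fun n => complex.Re (a n)) n)%:C
    + 'i%C * (series (fun n => complex.Im (a n)) n)%:C :> Cplx R).
  apply/funext => n; rewrite /series /= !rmorph_sum /= mulr_sumr -big_split /=.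
  by apply: eq_bigr => i _; exact: complexE.
apply/cvg_ex; eexists; apply: cvgD; first exact: real_complex_cvg cRe.
by apply: cvgM; [exact: cvg_cst|exact: real_complex_cvg cIm].
Qed.

Lemma power_series_expansion0 (F : Cplx R -> Cplx R) alpha :
  power_series_expansion F alpha -> F 0 = alpha 0%N.
Proof.
move=> expF.
have serF : series (fun j => alpha j * 0 ^+ j) @ \oo --> F 0.
  exact: (nbhs_singleton expF).
have ser0 : series (fun j => alpha j * 0 ^+ j) @ \oo --> alpha 0%N; last first.
  exact: cvg_unique serF ser0.
rewrite -cvg_shiftS (_ : (fun n => _) = cst (alpha 0%N)); first exact: cvg_cst.
apply/funext => n; rewrite /series /= big_nat_recl // expr0 mulr1 big1 ?addr0 //.
by move=> i _; rewrite expr0n mulr0.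
Qed.

(** A power series converging at some [w0 > 0] has coefficients bounded by
    [M / w0 ^+ n]; on the disc of radius [w0 / 8] the derived series is then
    dominated geometrically, hence converges, and [is_derive_pseries] applies.
    The conclusion has the form of the hypothesis, which makes the lemma
    iterable. *)
Lemma power_series_expansion_derive1 (F : Cplx R -> Cplx R) alpha :
  power_series_expansion F alpha ->
  (\forall w \near (0 : Cplx R), derivable F w 1) /\
  power_series_expansion F^`()%classic (fun j => j.+1%:R * alpha j.+1).
Proof.
move=> /nbhs_norm0P [rho /= rho0 serF].
pose w0 : Cplx R := rho / 2.
have w00 : 0 < w0 by rewrite divr_gt0.
have w0rho : w0 < rho by rewrite ltr_pdivrMr // mulr_natr mulr2n ltrDl.
have [M M0] : exists2 M, 0 <= M & forall n, `|alpha n| * `|w0| ^+ n <= M.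
  apply: pseries_coef_bounded; apply/cvg_ex; exists (F w0).
  by apply: serF; rewrite /= gtr0_norm.
rewrite gtr0_norm // => bM.
have deriv z : `|z| < w0 / 8 ->
    exists2 D, is_derive z (1 : Cplx R) F D
    & series (fun j => j.+1%:R * alpha j.+1 * z ^+ j) @ \oo --> D.
  move=> zw.
  have /cvg_ex [D serD] : cvgn (series (fun j => j.+1%:R * alpha j.+1 * z ^+ j)).
    apply: (@Cplx_series_cvg _ (M / w0)) => j.
    rewrite !normrM normr_nat normrX.
    have : j.+1%:R * `|alpha j.+1| * `|z| ^+ j <=
        j.+1%:R * `|alpha j.+1| * (w0 / 8) ^+ j.
      rewrite ler_wpM2l ?mulr_ge0 // lerXn2r ?nnegrE ?normr_ge0 ?divr_ge0 // ltW //.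
    move/le_trans; apply.
    have -> : j.+1%:R * `|alpha j.+1| * (w0 / 8) ^+ j =
        (`|alpha j.+1| * w0 ^+ j.+1) / w0 * (j.+1%:R * 8^-1 ^+ j).
      by rewrite exprMn exprS; field; rewrite gt_eqF.
    have w0_ge0 := ltW w00.
    apply: ler_pM.
    - by apply: divr_ge0 => //; apply: mulr_ge0 => //; exact: exprn_ge0.
    - by apply: mulr_ge0 => //; rewrite exprn_ge0 // invr_ge0.
    - by rewrite ler_wpM2r ?invr_ge0.
    rewrite natr_eighth_exp_le // (leq_trans (ltn_expl j (isT : 1 < 2)%N)) //.
    by rewrite (_ : 4 = 2 ^ 2)%N // -expnM leq_exp2l // leq_pmull.
  exists D; last exact: serD.
  apply: (is_derive_pseries w00 bM _ zw serD) => w wr; apply: serF => /=.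
  rewrite (le_lt_trans wr) // (lt_trans _ w0rho) // ltr_pdivrMr //.
  by rewrite ltr_pMr // ltr1n.
have r0 : 0 < w0 / 8 by rewrite divr_gt0.
have small : \forall z \near (0 : Cplx R), `|z| < w0 / 8 by exact: nbhs0_lt.
split; apply: (@filterS _ (nbhs (0 : Cplx R)) _ _ _ _ small) => z zw.
  by have [D [dF _] _] := deriv z zw.
have [D dF serD] := deriv z zw.
by rewrite derive1E (@derive_val _ _ _ _ _ _ _ dF).
Qed.
End ComplexSeries.

(** * Functions with the derivatives of a polynomial *)

Section Jet.
Variable K : numFieldType.
Implicit Types (F G : K -> K) (P Q : {poly K}) (a z : K).

Lemma is_derive_horner P a : is_derive a (1 : K) (horner P) P^`().[a].
Proof.
elim/poly_ind: P => [|P c IH].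
  have -> : horner (0 : {poly K}) = cst 0 by apply/funext => z; rewrite horner0.
  by rewrite deriv0 horner0; exact: is_derive_cst.
have -> : horner (P * 'X + c%:P) = horner P * id + cst c.
  by apply/funext => z; rewrite !hornerE.
have H := is_deriveD (is_deriveM IH (is_derive_id a 1)) (is_derive_cst c a 1).
apply: (is_derive_eq H).
rewrite derivMXaddC hornerD hornerM hornerX addr0; congr (_ + _).
  exact: mulr1.
exact: mulrC.
Qed.

Lemma horner_continuous_at P a : {for a, continuous (horner P)}.
Proof.
apply: differentiable_continuous; apply/derivable1_diffP.
by have [] := is_derive_horner P a.
Qed.

Lemma derive1_horner P : (horner P)^`()%classic = horner P^`().
Proof.
apply/funext => a; rewrite derive1E.
by have H := is_derive_horner P a; rewrite derive_val.
Qed.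

(** The derivatives of [F] at [a] up to order [n] are those of [P], and those of
    order below [n] are differentiable in a neighbourhood of [a]. The
    neighbourhood is what makes the notion stable under products: the Leibniz rule
    has to hold around [a] to be differentiated again. *)
Fixpoint jet n a F P : Prop :=
  F a = P.[a] /\
  if n is m.+1 then
    (\forall z \near a, derivable F z 1) /\ jet m a F^`()%classic P^`()
  else True.

Lemma jet_pred n a F P : jet n.+1 a F P -> jet n a F P.
Proof.
elim: n F P => [|n IH] F P [Fa [dF jF]]; first by [].
by split => //; split => //; exact: IH.
Qed.

Lemma jet_derive1n n a F P : jet n a F P -> derive1n n F a = P^`(n).[a].
Proof.
elim: n F P => [|n IH] F P [Fa]; first by [].
by move=> [dF jF]; rewrite derive1Sn (IH _ _ jF) -derivSn.
Qed.

Lemma near_eq_derive1 F G a : (\forall z \near a, F z = G z) ->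
  \forall z \near a, F^`()%classic z = G^`()%classic z.
Proof.
move=> /near_join; apply: filterS => z FG.
by rewrite !derive1E; exact: near_eq_derive.
Qed.

Lemma near_eq_jet n a F G P : (\forall z \near a, F z = G z) ->
  jet n a F P -> jet n a G P.
Proof.
elim: n F G P => [|n IH] F G P FG [Fa].
  by move=> _; split => //; rewrite -Fa; symmetry; exact: nbhs_singleton FG.
move=> [dF jF]; split.
  by rewrite -Fa; symmetry; exact: nbhs_singleton FG.
split; last by apply: IH jF; exact: near_eq_derive1.
apply: (@filterS2 _ (nbhs a) _ _ _ _ _ (near_join FG) dF) => z.
exact: near_eq_derivable.
Qed.

Lemma jet_horner n a P : jet n a (horner P) P.
Proof.
elim: n P => [|n IH] P; split => //; split.
  by apply: (@nearW _ (nbhs a)) => z; have [] := is_derive_horner P z.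
by rewrite derive1_horner.
Qed.

Lemma jetD n a F G P Q :
  jet n a F P -> jet n a G Q -> jet n a (fun z => F z + G z) (P + Q).
Proof.
elim: n F G P Q => [|n IH] F G P Q [Fa jF] [Ga jG]; split;
  rewrite ?hornerD ?Fa ?Ga //.
case: jF => dF jF; case: jG => dG jG; split.
  by apply: (@filterS2 _ (nbhs a) _ _ _ _ _ dF dG) => z; exact: derivableD.
rewrite derivD; apply: near_eq_jet (IH _ _ _ _ jF jG).
apply: (@filterS2 _ (nbhs a) _ _ _ _ _ dF dG) => z dFz dGz.
by rewrite !derive1E; symmetry; exact: deriveD.
Qed.

Lemma jet_sum n a d (F : 'I_d -> K -> K) (P : 'I_d -> {poly K}) :
  (forall k, jet n a (F k) (P k)) ->
  jet n a (fun z => \sum_(k < d) F k z) (\sum_(k < d) P k).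
Proof.
elim: d F P => [|d IH] F P jFP.
  have -> : (fun z => \sum_(k < 0) F k z) = horner (0 : {poly K}).
    by apply/funext => z; rewrite big_ord0 horner0.
  by rewrite big_ord0; exact: jet_horner.
rewrite big_ord_recr /=.
under eq_fun do rewrite big_ord_recr /=.
by apply: jetD => //; exact: (IH (fun k => F (widen_ord (leqnSn d) k))).
Qed.

Lemma jetM n a F G P Q :
  jet n a F P -> jet n a G Q -> jet n a (fun z => F z * G z) (P * Q).
Proof.
elim: n F G P Q => [|n IH] F G P Q jF jG.
  by case: jF jG => Fa _ [Ga _]; split => //; rewrite hornerM Fa Ga.
have [jF0 jG0] := (jet_pred jF, jet_pred jG).
case: jF jG => Fa [dF jF] [Ga [dG jG]].
split; first by rewrite hornerM Fa Ga.
split; first by apply: (@filterS2 _ (nbhs a) _ _ _ _ _ dF dG) => z; exact: derivableM.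
rewrite derivM; apply: near_eq_jet (jetD (IH _ _ _ _ jF jG0) (IH _ _ _ _ jF0 jG)).
apply: (@filterS2 _ (nbhs a) _ _ _ _ _ dF dG) => z dFz dGz.
have := deriveM dFz dGz; rewrite !derive1E => ->.
by rewrite addrC; congr (_ + _); exact: mulrC.
Qed.

End Jet.

Section Compose.
Variable K : numFieldType.

Lemma is_derive_comp (F G : K -> K) (a dF dG : K) :
  is_derive a (1 : K) G dG -> is_derive (G a) (1 : K) F dF ->
  is_derive a (1 : K) (F \o G) (dF * dG).
Proof.
move=> [dGa <-] [dFa <-].
have difG : differentiable G a by exact/derivable1_diffP.
have difF : differentiable F (G a) by exact/derivable1_diffP.
have dFG := differentiable_comp difG difF.
split; first exact/derivable1_diffP.
rewrite deriveE // diff_comp //= (deriv1E dFa) (deriveE _ difG) derive1E.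
exact: mulrC.
Qed.

Lemma near_derive_comp_horner (F : K -> K) (p : {poly K}) (a : K) :
  root p a -> (\forall w \near (0 : K), derivable F w 1) ->
  \forall z \near a, derivable (fun z => F p.[z]) z 1 /\
    F^`()%classic p.[z] * p^`().[z] = (fun z => F p.[z])^`()%classic z.
Proof.
move=> /rootP pa dF.
rewrite -pa in dF; apply: (@filterS _ (nbhs a) _ _ _ _ (horner_continuous_at dF)) => z dFz.
have dFp : is_derive z (1 : K) (fun z => F p.[z]) (F^`()%classic p.[z] * p^`().[z]).
  apply: (@is_derive_comp F (horner p)); first exact: is_derive_horner.
  by split; [exact: dFz|exact/esym/derive1E].
split; first by case: dFp.
exact: (esym (etrans (derive1E _ _) (@derive_val _ _ _ _ _ _ _ dFp))).
Qed.
End Compose.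

Section ComplexJet.
Variable R : realType.

(** Substituting [p] in a power series [F] has the derivatives at a root of [p]
    that formal substitution predicts. One differentiation turns [F \o p] into
    [(F' \o p) * p'], where [F'] is again a power series, and [B \Po p] into
    [(B' \Po p) * p']; the agreement of [B] with [alpha] loses one degree. *)
Lemma jet_power_series n (a : Cplx R) (p B : {poly Cplx R}) F alpha :
  root p a -> power_series_expansion F alpha ->
  (forall i, (i <= n)%N -> B`_i = alpha i) ->
  jet n a (fun z => F p.[z]) (B \Po p).
Proof.
move=> pa; elim: n B F alpha => [|n IH] B F alpha serF BE;
  have [dF serF'] := power_series_expansion_derive1 serF;
  have value : F p.[a] = (B \Po p).[a] by
    rewrite horner_comp (rootP pa) horner_coef0 BE // (power_series_expansion0 serF).
  by split.
have near_p := near_derive_comp_horner pa dF.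
split; first exact: value.
split; first by apply: (@filterS _ (nbhs a) _ _ _ _ near_p) => z [].
rewrite deriv_comp.
have jF' : jet n a (fun z => F^`()%classic p.[z]) (B^`() \Po p).
  apply: (IH _ _ _ serF') => i i_n.
  by rewrite coef_deriv BE // mulr_natl.
apply: near_eq_jet (jetM jF' (jet_horner n a p^`())).
by apply: (@filterS _ (nbhs a) _ _ _ _ near_p) => z [].
Qed.
End ComplexJet.

(** Near a root, [phi] is the multicentric sum, because [p] is small there; the
    jet of each summand is known. *)
Lemma multicentric_jet (R : realType) n d (p : {poly Cplx R})
    (lam : 'I_d -> Cplx R) phi f alpha m :
  root p (lam m) ->
  multicentric_representation p lam phi f ->
  (forall k, power_series_expansion (f k) (alpha k)) ->
  jet n (lam m) phi (\sum_(k < d) lagrange_basis lam k *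
    (\poly_(i < n.+1) alpha k i \Po p)).
Proof.
move=> pm [_ [r r0 phiE]] expf.
have small : \forall w \near p.[lam m], `|w| < r.
  by rewrite (rootP pm); exact: nbhs0_lt.
have near_phi : \forall z \near lam m,
    \sum_(k < d) (lagrange_basis lam k).[z] * f k p.[z] = phi z.
  apply: (@filterS _ (nbhs (lam m)) _ _ _ _ (horner_continuous_at small)) => z pz.
  by rewrite (phiE z pz).
apply: near_eq_jet near_phi _.
apply: (@jet_sum _ n (lam m) d (fun k z => (lagrange_basis lam k).[z] * f k p.[z])) => k.
apply: jetM; first exact: jet_horner.
by apply: jet_power_series (expf k) _ => // i i_n; rewrite coef_poly ltnS i_n.
Qed.

(** * The field of Gaussian rationals *)

Section GaussianRationals.
Variable R : realType.
Local Open Scope complex_scope.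

(** Boolean form of [gaussian_rational], needed to attach the closure properties
    of a subfield to it. *)
Definition gaussian_pred : {pred Cplx R} := fun z => `[< gaussian_rational z >].

Lemma gaussianP z : reflect (gaussian_rational z) (z \in gaussian_pred).
Proof. exact: asboolP. Qed.

Lemma gaussian_divring_closed : divring_closed gaussian_pred.
Proof.
split=> [|x y|x y].
- by apply/gaussianP; split; [exists 1; rewrite //= rmorph1|exists 0; rewrite //= rmorph0].
- move=> /gaussianP [[a _ ax] [b _ bx]] /gaussianP [[c _ cy] [e _ ey]].
  apply/gaussianP; split; [exists (a - c)|exists (b - e)] => //.
    by rewrite [LHS]rmorphB /= ax cy; case: x y {ax bx cy ey} => [? ?] [? ?].
  by rewrite [LHS]rmorphB /= bx ey; case: x y {ax bx cy ey} => [? ?] [? ?].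
move=> /gaussianP [[a _ ax] [b _ bx]] /gaussianP [[c _ cy] [e _ ey]].
apply/gaussianP.
(* [(c + i e)^-1 = c / N - i (e / N)]. *)
pose N := c ^+ 2 + e ^+ 2.
case: x y ax bx cy ey => [? ?] [? ?] /= <- <- <- <-.
split; [exists (a * (c / N) - b * - (e / N))|exists (a * - (e / N) + b * (c / N))] => //=.
  by rewrite rmorphB !(rmorphM, rmorphN, fmorphV, rmorphD, rmorphXn).
by rewrite !(rmorphD, rmorphM, rmorphN, fmorphV, rmorphXn).
Qed.
HB.instance Definition _ :=
  GRing.isDivringClosed.Build (Cplx R) gaussian_pred gaussian_divring_closed.

Lemma lagrange_basis_gaussian d (lam : 'I_d -> Cplx R) k :
  (forall i, lam i \in gaussian_pred) ->
  lagrange_basis lam k \is a polyOver gaussian_pred.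
Proof.
move=> lamG; apply: rpred_prod => j _.
apply: polyOverZ; first by rewrite rpredV rpredB.
by rewrite rpredB ?polyOverX ?polyOverC.
Qed.

Lemma deriven_gaussian n (Q : {poly Cplx R}) a :
  Q \is a polyOver gaussian_pred -> a \in gaussian_pred -> Q^`(n).[a] \in gaussian_pred.
Proof. by move=> QG aG; rewrite rpred_horner // polyOver_derivn. Qed.
End GaussianRationals.

(** * Recovering the coefficients *)

(** Only the term in which every derivative falls on the power of [X - a]
    survives at [a]. *)
Lemma deriv_exp_XsubC (F : idomainType) (a : F) (Q : {poly F}) n :
  ((('X - a%:P) ^+ n * Q)^`(n)).[a] = n`!%:R * Q.[a].
Proof.
elim: n Q => [|n IH] Q; first by rewrite expr0 !mul1r.
have dE : deriv (('X - a%:P) ^+ n.+1 * Q) =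
    ('X - a%:P) ^+ n * (n.+1%:R *: Q + ('X - a%:P) * deriv Q).
  rewrite derivM deriv_exp derivXsubC mul1r /= exprSr -mulrA mulrDr; congr (_ + _).
  by rewrite mulrnAl -scaler_nat scalerAr.
rewrite derivSn dE IH hornerD hornerM hornerXsubC subrr mul0r addr0 hornerZ mulrA.
by rewrite factS mulnC natrM.
Qed.

Lemma factor_XsubC_root (F : fieldType) d (p : {poly F}) (lam : 'I_d -> F) m :
  size p = d.+1 -> injective lam -> (forall k, root p (lam k)) ->
  p = ('X - (lam m)%:P) *
      (lead_coef p *: \prod_(k < d | k != m) ('X - (lam k)%:P)).
Proof.
move=> sz_p inj_lam root_p; set q := _ *: _.
rewrite [LHS](@all_roots_prod_XsubC _ p [seq lam k | k <- index_enum 'I_d]).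
- by rewrite big_map (bigD1 m) //= -scalerAr.
- by rewrite size_map sz_p -[index_enum _]enumT size_enum_ord.
- by apply/allP => _ /mapP [k _ ->]; exact: root_p.
- by rewrite uniq_rootsE map_inj_uniq // index_enum_uniq.
Qed.

Theorem proposition1p1 (R : realType) (d : nat) (hd : (1 <= d)%N)
    (p : {poly Cplx R}) (hdeg : size p = d.+1)
    (hlead : gaussian_rational (lead_coef p))
    (lam : 'I_d -> Cplx R) (hinj : injective lam)
    (hroot : forall k, root p (lam k))
    (hlam : forall k, gaussian_rational (lam k))
    (phi : Cplx R -> Cplx R) (hphi : holomorphic_near (range lam) phi)
    (hval : forall (nu : nat) (k : 'I_d),
        gaussian_rational (derive1n nu phi (lam k)))
    (f : 'I_d -> Cplx R -> Cplx R)
    (hf : multicentric_representation p lam phi f)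
    (alpha : 'I_d -> nat -> Cplx R)
    (halpha : forall k, power_series_expansion (f k) (alpha k)) :
  forall (k : 'I_d) (j : nat), gaussian_rational (alpha k j).
Proof.
pose G := @gaussian_pred R.
have lamG k : lam k \in G by exact/gaussianP.
have leadG : lead_coef p \in G by exact/gaussianP.
move=> m j; apply/gaussianP; move: m.
elim/ltn_ind: j => j IH m.
pose q := lead_coef p *: \prod_(k < d | k != m) ('X - (lam k)%:P).
have pE : p = ('X - (lam m)%:P) * q by exact: factor_XsubC_root.
have qG : q \is a polyOver G.
  apply: polyOverZ => //; apply: rpred_prod => k _.
  by rewrite rpredB ?polyOverX ?polyOverC.
have pG : p \is a polyOver G by rewrite pE rpredM // rpredB ?polyOverX ?polyOverC.
have qm0 : q.[lam m] != 0.
  rewrite hornerZ mulf_neq0 ?lead_coef_eq0 -?size_poly_eq0 ?hdeg //.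
  rewrite horner_prod; apply/prodf_neq0 => k km.
  by rewrite hornerXsubC subr_eq0 (inj_eq hinj) eq_sym.
pose Q := \sum_(k < d) lagrange_basis lam k * (\poly_(i < j) alpha k i \Po p).
have QG : Q \is a polyOver G.
  apply: rpred_sum => k _; rewrite rpredM ?lagrange_basis_gaussian //.
  by rewrite polyOver_comp // polyOver_poly // => i ij; exact: IH.
pose S := \sum_(k < d) alpha k j *: lagrange_basis lam k.
have Sm : S.[lam m] = alpha m j.
  rewrite horner_sum (bigD1 m) //= big1 => [|k km].
    by rewrite hornerZ lagrange_basisE // eqxx mulr1 addr0.
  by rewrite hornerZ lagrange_basisE // eq_sym (negbTE km) mulr0.
have splitE : \sum_(k < d) lagrange_basis lam k *
    (\poly_(i < j.+1) alpha k i \Po p) = Q + ('X - (lam m)%:P) ^+ j * (q ^+ j * S).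
  rewrite mulrA -exprMn -pE mulr_sumr -big_split; apply: eq_bigr => k _ /=.
  rewrite [\poly_(i < j.+1) _]poly_def big_ord_recr /= -poly_def comp_polyD mulrDr.
  by congr (_ + _); rewrite comp_polyZ comp_Xn_poly -!scalerAr mulrC.
have /jet_derive1n := multicentric_jet j (hroot m) hf halpha.
rewrite splitE derivnD hornerD deriv_exp_XsubC hornerM horner_exp Sm mulrA => phiE.
have c0 : j`!%:R * q.[lam m] ^+ j != 0.
  by rewrite mulf_neq0 ?expf_neq0 // pnatr_eq0 -lt0n fact_gt0.
have -> : alpha m j = (derive1n j phi (lam m) - Q^`(j).[lam m])
    / (j`!%:R * q.[lam m] ^+ j).
  by rewrite phiE [_ + _ - _]addrAC subrr add0r mulrC mulKf.
rewrite rpred_div ?rpredB ?deriven_gaussian //.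
  by apply/gaussianP.
by rewrite rpredM ?rpred_nat // rpredX // rpred_horner.
Qed.
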